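(* Let $k\geq2$ (even or odd), and let $q:\mathbb{R}^2\to\mathbb{R}$ be a homogeneous harmonic polynomial of degree $k$. For any pair of constants $a,b\neq0$, consider the homogeneous harmonic polynomial $p:\mathbb{R}^4\to\mathbb{R}$ of degree $k$ given by $$p(x_1,y_1,x_2,y_2)=a\,q(x_1,y_1)+b\,q(x_2,y_2).$$ Then the zero set $\Sigma_p=\{p=0\}$ separates $\mathbb{R}^4$ into two components, i.e. $\mathbb{R}^4\setminus\Sigma_p$ has exactly two connected components.
   Context: Constants $a,b$ are real. A homogeneous polynomial of degree $k$ is understood to be nonzero. *)

(* Defs.v *)
From HB Require Import structures.
From mathcomp Require Import all_boot all_order all_algebra.
From mathcomp Require Import all_classical all_reals all_analysis.
(* The notations of [mpoly] clash with those of mathcomp-analysis. *)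
From mathcomp Require mpoly.
Import -(notations) mpoly.
Import Order.TTheory GRing.Theory Num.Theory.
Import numFieldNormedType.Exports.

Set Implicit Arguments.
Unset Strict Implicit.
Unset Printing Implicit Defensive.

Local Open Scope classical_set_scope.
Local Open Scope ring_scope.

Definition laplacian (n : nat) (R : nzRingType) (p : mpoly n R) : mpoly n R :=
  \sum_(i < n) mderiv i (mderiv i p).

(* [ishomog1 k mdeg] is [k.-homog]; it contains 0, which is excluded here. *)
Definition homogeneous_harmonic (n : nat) (R : nzRingType) (k : nat)
    (p : mpoly n R) : Prop :=
  [/\ p != 0, p \is ishomog1 k mdeg & laplacian p = 0].

(* The polynomial a q(x_1, y_1) + b q(x_2, y_2), with the four variables
   (x_1, y_1, x_2, y_2) indexed by 0, 1, 2, 3; see [meval_two_copies]. *)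
Definition two_copies (R : nzRingType) (a b : R) (q : mpoly 2 R) : mpoly 4 R :=
  a *: comp_mpoly [tuple mpolyX R (mnm1 (lshift 2 i)) | i < 2] q
  + b *: comp_mpoly [tuple mpolyX R (mnm1 (rshift 2 i)) | i < 2] q.

Definition zero_set (n : nat) (R : nzRingType) (p : mpoly n R)
    : set 'rV[R]_n :=
  [set x | meval (x ord0) p = 0].

Definition connected_components (T : topologicalType) (A : set T)
    : set (set T) :=
  [set connected_component A x | x in A].

Lemma meval_two_copies (R : comNzRingType) (a b : R) (q : mpoly 2 R)
    (x1 y1 x2 y2 : R) :
  meval (tnth [tuple x1; y1; x2; y2]) (two_copies a b q) =
  a * meval (tnth [tuple x1; y1]) q + b * meval (tnth [tuple x2; y2]) q.
Proof.
rewrite /two_copies mevalD !mevalZ !comp_mpoly_meval.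
by congr (_ * _ + _ * _); apply: meval_eq => i;
  rewrite !tnth_map tnth_ord_tuple mevalXU; case: i => [[|[|//]] ?].
Qed.

(* Main.v *)
Require Import Defs.
From mathcomp Require Import all_boot all_order all_algebra.
From mathcomp Require Import all_classical all_reals all_analysis.
From mathcomp Require mpoly.
From mathcomp Require Import ring.
Import -(notations) mpoly.
Import Order.TTheory GRing.Theory Num.Theory.
Import numFieldNormedType.Exports.
Local Open Scope classical_set_scope.
Local Open Scope ring_scope.

Set Implicit Arguments.
Unset Strict Implicit.
Unset Printing Implicit Defensive.

(** Write p(z, w) = a q(z) + b q(w) with z and w in the plane.  The claim
    reduces to the connectedness of {p > 0}: replacing (a, b) by (-a, -b)
    turns it into that of {p < 0}, and since p has constant sign on every
    connected subset of {p <> 0}, two connected nonempty sets {p > 0} and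
    {p < 0} are exactly the components ([components_sign]).

    The set {p > 0} is connected by segments, because q is homogeneous and
    a q and b q both take positive values ([connected_positive_sum]).  If
    a q(z) + b q(w) > 0, one of the terms is positive, say a q(z); contracting
    w to 0 multiplies the other term by a factor s^k in [0, 1], which keeps
    the sum positive, so (z, w) is joined to (z, 0) inside {p > 0}.  Any
    (z, 0) and (0, w) with a q(z) > 0 and b q(w) > 0 are joined by the segment
    of the points (s z, t w) with s + t = 1, on which the value is
    s^k a q(z) + t^k b q(w) > 0.  Hence all points of {p > 0} are linked to
    each other through the two coordinate planes.

    That a harmonic q takes both signs comes from the angular derivative
    D = x d/dy - y d/dx.  Euler's identity and harmonicity give
    D^2 q = - k^2 q ([angular_deriv2]), so along each circle g(t) = q(z(t))
    solves g'' = - k^2 g, whence g(t + pi/k) = - g(t): rotating by pi/k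
    changes the sign of q ([harmonic_rotate]).  It remains to know that a
    nonzero homogeneous polynomial has a nonzero value
    ([dhomog_meval_neq0]).

    Harmonicity of p itself is the formal chain rule for an injective renaming
    of the variables ([laplacian_rename]). *)

Local Notation X i := (mpolyX _ (mnm1 i)).

(** * Formal derivatives and substitution *)

(** Identities between derivatives are compatible with the ring operations
    but awkward on monomials; this principle avoids the monomial basis. *)
Lemma mpoly_alg_ind (n : nat) (R : nzRingType) (P : mpoly n R -> Prop) :
  (forall c, P (mpolyC n c)) -> (forall i, P (X i)) ->
  (forall p q, P p -> P q -> P (p + q)) ->
  (forall p q, P p -> P q -> P (p * q)) ->
  forall p, P p.
Proof.
move=> PC PX PD PM; elim/mpolyind => [|c m p _ _ IHp].
  by rewrite -mpolyC0; apply: PC.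
apply: PD IHp; rewrite -mul_mpolyC; apply: (PM _ _ (PC c)).
rewrite mpolyXE_id; apply: big_ind => [||i _]; [by rewrite -mpolyC1|exact: PM|].
elim: (m i) => [|d IHd]; first by rewrite expr0 -mpolyC1.
by rewrite exprS; exact: PM.
Qed.

Lemma mderiv_var (n : nat) (R : nzRingType) (i j : 'I_n) :
  mderiv i (X j) = (j == i)%:R :> mpoly n R.
Proof.
rewrite mderivX mnm1E; case: eqVneq => [->|_]; last by rewrite scale0r.
rewrite scale1r -[RHS]mpolyX0; congr mpolyX.
by apply/mnmP => l; rewrite mnmBE mnm0E subnn.
Qed.

Lemma mderiv_comp_mpoly (n m : nat) (R : comNzRingType)
    (f : n.-tuple (mpoly m R)) (j : 'I_m) (p : mpoly n R) :
  mderiv j (comp_mpoly f p) =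
  \sum_i comp_mpoly f (mderiv i p) * mderiv j (tnth f i).
Proof.
elim/mpoly_alg_ind: p => [c|l|p q IHp IHq|p q IHp IHq].
- rewrite comp_mpolyC mderivC big1 // => i _.
  by rewrite mderivC comp_mpoly0 mul0r.
- rewrite comp_mpolyXU -tnth_nth (bigD1 l) //= mderiv_var eqxx.
  rewrite comp_mpoly1 mul1r big1 ?addr0 // => i /negPf il.
  by rewrite mderiv_var eq_sym il comp_mpoly0 mul0r.
- rewrite comp_mpolyD mderivD IHp IHq -big_split; apply: eq_bigr => i _.
  by rewrite mderivD comp_mpolyD mulrDl.
- rewrite rmorphM mderivM IHp IHq mulr_suml mulr_sumr -big_split.
  apply: eq_bigr => i _ /=.
  by rewrite mderivM comp_mpolyD !rmorphM mulrDl mulrAC mulrA.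
Qed.

Lemma laplacianD (n : nat) (R : nzRingType) (p q : mpoly n R) :
  laplacian (p + q) = laplacian p + laplacian q.
Proof.
by rewrite /laplacian -big_split; apply: eq_bigr => i _; rewrite !mderivD.
Qed.

Lemma laplacianZ (n : nat) (R : nzRingType) (c : R) (p : mpoly n R) :
  laplacian (c *: p) = c *: laplacian p.
Proof.
by rewrite /laplacian scaler_sumr; apply: eq_bigr => i _; rewrite !mderivZ.
Qed.

Section Rename.
Variables (n m : nat) (R : comNzRingType) (f : 'I_n -> 'I_m).
Local Notation ren := (comp_mpoly [tuple mpolyX R (mnm1 (f i)) | i < n]).

(** By the chain rule the Hessian of the renamed polynomial has the entries
    of the old one, renamed, at the places (f i, f j), and zeros elsewhere.
    As f is injective, the diagonal sees only the old diagonal. *)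
Lemma laplacian_rename (p : mpoly n R) : injective f ->
  laplacian (ren p) = ren (laplacian p).
Proof.
move=> f_inj.
have dren j r : mderiv j (ren r) = \sum_i ren (mderiv i r) * (f i == j)%:R.
  rewrite mderiv_comp_mpoly; apply: eq_bigr => i _.
  by rewrite tnth_map tnth_ord_tuple mderiv_var.
have drenf i r : mderiv (f i) (ren r) = ren (mderiv i r).
  rewrite dren (bigD1 i) //= eqxx mulr1 big1 ?addr0 // => l li.
  by rewrite (inj_eq f_inj) (negPf li) mulr0.
rewrite /laplacian raddf_sum /=.
under eq_bigr => j _.
  rewrite dren raddf_sum /=.
  under eq_bigr => i _.
    rewrite (_ : mderiv j _ = ren (mderiv i (mderiv i p)) * (f i == j)%:R).
      over.
    case: eqVneq => [<-|_]; first by rewrite !mulr1 drenf.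
    by rewrite !mulr0 mderiv0.
  over.
rewrite exchange_big; apply: eq_bigr => i _ /=.
rewrite (bigD1 (f i)) //= eqxx mulr1 big1 ?addr0 // => j.
by rewrite eq_sym => /negPf ->; rewrite mulr0.
Qed.

Lemma dhomog_rename (k : nat) (p : mpoly n R) :
  p \is ishomog1 k mdeg -> ren p \is ishomog1 k mdeg.
Proof.
move=> /dhomogP hp; rewrite comp_mpolyE big_seq.
apply: rpred_sum => d /hp /= <-; apply: rpredZ.
rewrite mdegE; under eq_bigr do rewrite tnth_map tnth_ord_tuple.
elim/big_rec2: _ => [|i r e _ h]; first exact: dhomog1.
apply: dhomogM => //; rewrite -[d' in ishomog1 d']mul1n; apply: dhomogMn.
by rewrite dhomogX /= mdeg1.
Qed.

End Rename.

(** * Homogeneous polynomials *)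

Lemma mderiv_dhomog (n k : nat) (R : nzRingType) (i : 'I_n) (p : mpoly n R) :
  p \is ishomog1 k.+1 mdeg -> mderiv i p \is ishomog1 k mdeg.
Proof.
move=> /dhomogP hp; apply/dhomogP => m; rewrite mcoeff_msupp mcoeff_mderiv => nz.
have /hp/eqP : mnm_add m (mnm1 i) \in msupp p.
  by rewrite mcoeff_msupp; apply: contraNneq nz => ->; rewrite mul0rn.
by rewrite /= mdegD mdeg1 addn1 eqSS => /eqP.
Qed.

Lemma meval_dhomogZ (n k : nat) (R : comNzRingType) (p : mpoly n R)
    (v : 'I_n -> R) (t : R) : p \is ishomog1 k mdeg ->
  meval (fun i => t * v i) p = t ^+ k * meval v p.
Proof.
move=> /dhomogP hp; rewrite !mevalE mulr_sumr big_seq [RHS]big_seq.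
apply: eq_bigr => m /hp /= <-; rewrite mulrCA; congr (_ * _).
by under eq_bigr do rewrite exprMn; rewrite big_split /= prodrXr mdegE.
Qed.

Lemma euler_dhomog (n k : nat) (R : comNzRingType) (p : mpoly n R) :
  p \is ishomog1 k mdeg -> \sum_i X i * mderiv i p = p *+ k.
Proof.
move=> /dhomogP hp.
transitivity (\sum_(m <- msupp p) (mcoeff m p *: mpolyX R m) *+ mdeg m); last first.
  rewrite [p in RHS]mpolyE big_seq -sumrMnl [RHS]big_seq.
  by apply: eq_bigr => m /hp /= ->.
under eq_bigr => i _.
  rewrite [p in mderiv _ p]mpolyE raddf_sum mulr_sumr.
  under eq_bigr => m _.
    rewrite /= mderivZ mderivX -scalerAr -scalerAr scalerA -mpolyXD.
    rewrite (_ : _ *: _ = (mcoeff m p *: mpolyX R m) *+ m i); last first.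
      have [->|mi] := eqVneq (m i) 0%N; first by rewrite mulr0 scale0r.
      rewrite addmC submK ?lep1mP // -scalerA scalerMnr; congr (_ *: _).
      by rewrite scaler_nat.
    over.
  over.
by rewrite exchange_big; apply: eq_bigr => m _; rewrite mdegE sumrMnr.
Qed.

(** * Evaluation as a real function *)

Lemma is_derive_meval (n : nat) (R : realType) (p : mpoly n R)
    (c : R -> 'I_n -> R) (c' : 'I_n -> R) (t : R) :
  (forall i, is_derive t 1 (fun s => c s i) (c' i)) ->
  is_derive t 1 (fun s => meval (c s) p)
    (\sum_i meval (c t) (mderiv i p) * c' i).
Proof.
move=> hc; elim/mpoly_alg_ind: p => [a|l|p q IHp IHq|p q IHp IHq].
- rewrite (_ : (fun _ => _) = cst a); last first.
    by apply/funext => s; rewrite mevalC.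
  apply: is_derive_eq; rewrite big1 // => i _.
  by rewrite mderivC meval0 mul0r.
- rewrite (_ : (fun _ => _) = (fun s => c s l)); last first.
    by apply/funext => s; rewrite mevalXU.
  apply: is_derive_eq; rewrite (bigD1 l) //= mderiv_var eqxx meval1 mul1r.
  rewrite big1 ?addr0 // => i il.
  by rewrite mderiv_var eq_sym (negPf il) meval0 mul0r.
- rewrite (_ : (fun _ => _) =
      (fun s => meval (c s) p) + (fun s => meval (c s) q)); last first.
    by apply/funext => s; rewrite mevalD.
  apply: is_derive_eq; rewrite -big_split; apply: eq_bigr => i _ /=.
  by rewrite mderivD mevalD mulrDl.
- rewrite (_ : (fun _ => _) =
      (fun s => meval (c s) p) * (fun s => meval (c s) q)); last first.
    by apply/funext => s; rewrite mevalM.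
  apply: is_derive_eq; rewrite !scaler_sumr -big_split; apply: eq_bigr => i _ /=.
  by rewrite mderivM mevalD !mevalM /GRing.scale /=; ring.
Qed.

Lemma continuous_meval (n : nat) (R : realType) (p : mpoly n R) :
  continuous (fun x : 'rV[R]_n => meval (x ord0) p).
Proof.
elim/mpoly_alg_ind: p => [a|l|p q IHp IHq|p q IHp IHq] x.
- rewrite (_ : (fun _ => _) = cst a); first exact: cst_continuous.
  by apply/funext => s; rewrite mevalC.
- rewrite (_ : (fun _ => _) = (fun y : 'rV[R]_n => y ord0 l)).
    exact: coord_continuous.
  by apply/funext => s; rewrite mevalXU.
- rewrite (_ : (fun _ => _) = (fun y : 'rV[R]_n => meval (y ord0) p) +
      (fun y => meval (y ord0) q)).
    by apply: continuousD; [apply: IHp|apply: IHq].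
  by apply/funext => s; rewrite mevalD.
- rewrite (_ : (fun _ => _) = (fun y : 'rV[R]_n => meval (y ord0) p) *
      (fun y => meval (y ord0) q)).
    by apply: continuousM; [apply: IHp|apply: IHq].
  by apply/funext => s; rewrite mevalM.
Qed.

(** If all the values vanish, so do those of the partial derivatives, which
    are zero by induction on the degree; Euler's identity then kills the
    polynomial. *)
Lemma dhomog_meval_neq0 (n k : nat) (R : realType) (p : mpoly n R) :
  p \is ishomog1 k mdeg -> p != 0 -> exists v, meval v p != 0.
Proof.
move=> hp; apply: contra_neqP => /forallNP p0.
have {}p0 v : meval v p = 0 by apply/eqP/negbNE/negP/p0.
elim: k => [|k IHk] in p hp p0 *.
  have pC : p = mpolyC n (mcoeff (mnm0 (n := n)) p).
    apply/mpolyP => m; rewrite mcoeffC eq_sym.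
    have [->|m0] := eqVneq m (mnm0 (n := n)); first by rewrite mulr1.
    by rewrite mulr0; apply: dhomog_nemf_coeff hp _; rewrite /= mdeg_eq0.
  by have := p0 (fun=> 0); rewrite pC mevalC => ->; rewrite mpolyC0.
suff d0 i : mderiv i p = 0.
  apply: (scalerI (a := k.+1%:R)); first by rewrite pnatr_eq0.
  rewrite scaler0 scaler_nat -(euler_dhomog hp).
  by rewrite big1 // => i _; rewrite d0 mulr0.
apply: IHk => [|v]; first exact: mderiv_dhomog.
(* The line through v in the direction of the i-th variable. *)
have hc j : is_derive (0 : R) 1 (fun s => v j + s * (j == i)%:R) (j == i)%:R.
  rewrite (_ : (fun _ => _) = cst (v j) + (fun s => (j == i)%:R * s)).
    by apply: is_derive_eq; rewrite /= add0r; apply/mulr1.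
  by apply/funext => s; rewrite mulrC.
have := is_derive_meval p hc.
rewrite (_ : (fun _ => meval _ p) = cst 0); last by apply/funext => s; exact: p0.
move=> /@derive_val; rewrite derive_cst (bigD1 i) //= eqxx mulr1.
rewrite big1 ?addr0 => [->|j /negPf ->]; last by rewrite mulr0.
by apply: meval_eq => j; rewrite mul0r addr0.
Qed.

(** * Harmonic polynomials in the plane *)

Local Notation i0 := (@ord0 1).
Local Notation i1 := (lift (@ord0 1) (@ord0 0)).

Definition angular_deriv (R : nzRingType) (p : mpoly 2 R) : mpoly 2 R :=
  X i0 * mderiv i1 p - X i1 * mderiv i0 p.

(** With D the angular derivative and E = x d/dx + y d/dy the Euler operator,
    D^2 + E^2 is (x^2 + y^2) times the Laplacian, and E^2 p = k^2 p. *)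
Lemma angular_deriv2 (R : comNzRingType) (k : nat) (p : mpoly 2 R) :
  p \is ishomog1 k mdeg -> laplacian p = 0 ->
  angular_deriv (angular_deriv p) = - (p *+ (k * k)).
Proof.
move=> /euler_dhomog; rewrite /laplacian !big_ord_recl !big_ord0 !addr0.
move=> euler harm.
(* Euler's identity, used twice, turns k^2 p into E (E p). *)
rewrite mulrnA -{1}euler mulrnDl -!mulrnAr -!mderivMn -euler /angular_deriv.
rewrite !(mderivD, mderivB, mderivN, mderivM, mderiv_var) /= (mderiv_comm i1 i0).
apply/eqP; rewrite -subr_eq0; apply/eqP.
transitivity ((X i0 ^+ 2 + X i1 ^+ 2) *
  (mderiv i0 (mderiv i0 p) + mderiv i1 (mderiv i1 p))).
  ring.
by rewrite harm mulr0.
Qed.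

Definition rotate (R : realType) (z : 'rV[R]_2) (t : R) : 'rV[R]_2 :=
  \row_(i < 2) (if i == i0 then z ord0 i0 * cos t - z ord0 i1 * sin t
                else z ord0 i0 * sin t + z ord0 i1 * cos t).

Lemma is_derive_rotate (R : realType) (p : mpoly 2 R) (z : 'rV[R]_2) (t : R) :
  is_derive t 1 (fun s => meval (rotate z s ord0) p)
    (meval (rotate z t ord0) (angular_deriv p)).
Proof.
have h i : is_derive t 1 (fun s => rotate z s ord0 i)
    (if i == i0 then - rotate z t ord0 i1 else rotate z t ord0 i0).
  have -> : (fun s => rotate z s ord0 i) = if i == i0
      then z ord0 i0 *: cos - z ord0 i1 *: sin
      else z ord0 i0 *: sin + z ord0 i1 *: cos.
    by apply/funext => s; rewrite mxE; case: ifP.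
  have -> : rotate z t ord0 i1 = z ord0 i0 * sin t + z ord0 i1 * cos t.
    by rewrite mxE.
  have -> : rotate z t ord0 i0 = z ord0 i0 * cos t - z ord0 i1 * sin t.
    by rewrite mxE.
  have hs j := is_deriveZ (z ord0 j) (is_derive_sin t).
  have hc j := is_deriveZ (z ord0 j) (is_derive_cos t).
  case: ifP => _.
    apply: is_derive_eq (is_deriveB (hc i0) (hs i1)) _.
    by rewrite /GRing.scale /=; ring.
  apply: is_derive_eq (is_deriveD (hs i0) (hc i1)) _.
  by rewrite /GRing.scale /=; ring.
apply: is_derive_eq (is_derive_meval p h) _.
rewrite !big_ord_recl !big_ord0 /= addr0 /angular_deriv mevalB !mevalM !mevalXU.
ring.
Qed.

(** Along the circle through z, g(t) = p(z(t)) solves g'' = - k^2 g.  So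
    F = g cos(kt) - g' sin(kt) / k is constant, and it equals g(0) at t = 0 and
    - g(pi/k) at t = pi/k. *)
Lemma harmonic_rotate (R : realType) (k : nat) (p : mpoly 2 R) (z : 'rV[R]_2) :
  (0 < k)%N -> p \is ishomog1 k mdeg -> laplacian p = 0 ->
  meval (rotate z (pi / k%:R) ord0) p = - meval (z ord0) p.
Proof.
move=> k0 hp lp; have kR : k%:R != 0 :> R by rewrite pnatr_eq0 -lt0n.
pose g r t : R := meval (rotate z t ord0) r.
pose F : R -> R := g p * (cos \o (fun t => k%:R * t)) -
  k%:R^-1 *: (g (angular_deriv p) * (sin \o (fun t => k%:R * t))).
have dF (t : R) : is_derive t (1 : R) F 0.
  have h1 := is_derive_rotate p z t.
  have h2 := is_derive_rotate (angular_deriv p) z t.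
  rewrite (angular_deriv2 hp lp) mevalN mevalMn -mulr_natr natrM in h2.
  have hk : is_derive t 1 (fun s : R => k%:R * s) k%:R.
    by apply: is_derive_eq; rewrite /= [_ *: _]mulr1.
  rewrite /F; apply: is_derive_eq; rewrite /GRing.scale /=.
  rewrite -/(g p t) -/(g (angular_deriv p) t).
  by field.
have := @is_derive_0_is_cst R F (pi / k%:R) 0 dF.
rewrite /F !fctE /= [k%:R * (pi / _)]mulrC divfK // mulr0 sin0 cos0 sinpi cospi.
rewrite !mulr0 !scaler0 !subr0 mulr1 mulrN1 => /eqP; rewrite eqr_oppLR => /eqP.
rewrite /g => ->; congr (- _); apply: meval_eq => i.
rewrite mxE sin0 cos0 !mulr0 !mulr1 subr0 add0r.
by case: i => [[|[|//]] ?]; congr (z ord0 _); apply/val_inj.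
Qed.

Lemma harmonic_pos (R : realType) (k : nat) (q : mpoly 2 R) (c : R) :
  (0 < k)%N -> homogeneous_harmonic k q -> c != 0 ->
  exists z : 'rV[R]_2, 0 < c * meval (z ord0) q.
Proof.
move=> k0 [q0 hq lq] c0; have [v qv] := dhomog_meval_neq0 hq q0.
pose z := \row_i v i : 'rV[R]_2.
have qz : c * meval (z ord0) q != 0.
  by rewrite mulf_neq0 // (_ : z ord0 = v) //; apply/funext => i; rewrite mxE.
have [cz|] := ltP 0 (c * meval (z ord0) q); first by exists z.
rewrite le_eqVlt (negPf qz) /= => cz; exists (rotate z (pi / k%:R)).
by rewrite (harmonic_rotate z k0 hq lq) mulrN oppr_gt0.
Qed.

(** * Connectedness *)

Lemma segment_component (R : realType) (V : normedModType R) (A : set V)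
    (x y : V) :
  (forall s t : R, 0 <= s -> 0 <= t -> s + t = 1 -> A (s *: x + t *: y)) ->
  connected_component A x y.
Proof.
move=> Axy; pose c (t : R) := (1 - t) *: x + t *: y.
have c_cont : continuous c.
  move=> t; apply: cvgD; last exact: scalel_continuous.
  apply: cvgZr_tmp; apply: cvgB; [exact: cvg_cst|exact: cvg_id].
have conn : connected (c @` `[0, 1]).
  apply: connected_continuous_connected; first exact: segment_connected.
  exact: continuous_subspaceT.
apply: (connected_component_max _ _ conn).
- by exists 0; rewrite /c ?subr0 ?scale1r ?scale0r ?addr0 //= in_itv /= lexx ler01.
- move=> _ [t /= + <-]; rewrite in_itv /= => /andP[t0 t1].
  by apply: Axy; rewrite ?subr_ge0 // subrK.
- by exists 1; rewrite /c ?subrr ?scale1r ?scale0r ?add0r //= in_itv /= lexx ler01.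
Qed.

(** A point where u > 0 is joined to (z, 0) by shrinking its second component,
    a point where v > 0 is joined to (0, w) likewise, and the segments between
    positive points of the two coordinate subspaces link everything to a single
    base point (z0, 0). *)
Lemma connected_positive_sum (R : realType) (m n k : nat)
    (u : 'rV[R]_m -> R) (v : 'rV[R]_n -> R) :
  (0 < k)%N ->
  (forall t z, u (t *: z) = t ^+ k * u z) ->
  (forall t z, v (t *: z) = t ^+ k * v z) ->
  (exists z, 0 < u z) -> (exists z, 0 < v z) ->
  connected [set x : 'rV[R]_(m + n) | 0 < u (lsubmx x) + v (rsubmx x)].
Proof.
move=> k0 uZ vZ [z0 uz0] [w0 vw0]; set P := (X in connected X).
have cmp_seg z z' w w' :
    (forall s t : R, 0 <= s -> 0 <= t -> s + t = 1 ->
      0 < u (s *: z + t *: z') + v (s *: w + t *: w')) ->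
    connected_component P (row_mx z w) (row_mx z' w').
  move=> h; apply: segment_component => s t s0 t0 st.
  by rewrite !scale_row_mx add_row_mx /P /= row_mxKl row_mxKr; exact: h.
have shrink (c d s : R) : 0 <= s <= 1 -> 0 < c -> 0 < c + d -> 0 < c + s ^+ k * d.
  move=> /andP[s0 s1] c0 cd; have sk0 : 0 <= s ^+ k by apply: exprn_ge0.
  have sk1 : s ^+ k <= 1 by apply: exprn_ile1.
  have [d0|d0] := leP 0 d; first by apply: ltr_wpDr => //; apply: mulr_ge0.
  by apply: lt_le_trans cd _; rewrite lerD2l ler_niMl // ltW.
have le1 (s t : R) : 0 <= s -> 0 <= t -> s + t = 1 -> 0 <= s <= 1.
  by move=> s0 t0 st; rewrite s0 -st lerDl.
have toL z w : 0 < u z -> P (row_mx z w) ->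
    connected_component P (row_mx z w) (row_mx z 0).
  rewrite /P /= row_mxKl row_mxKr => uz uvzw; apply: cmp_seg => s t s0 t0 st.
  rewrite -scalerDl st scale1r scaler0 addr0 vZ.
  by apply: shrink => //; apply: le1 st.
have toR z w : 0 < v w -> P (row_mx z w) ->
    connected_component P (row_mx z w) (row_mx 0 w).
  rewrite /P /= row_mxKl row_mxKr => vw uvzw; apply: cmp_seg => s t s0 t0 st.
  rewrite -scalerDl st scale1r scaler0 addr0 uZ addrC.
  by apply: shrink; rewrite 1?addrC //; apply: le1 st.
have axes z w : 0 < u z -> 0 < v w ->
    connected_component P (row_mx z 0) (row_mx 0 w).
  move=> uz vw; apply: cmp_seg => s t s0 t0 st.
  rewrite !scaler0 addr0 add0r uZ vZ; have [t00|t00] := eqVneq t 0.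
    move: st; rewrite t00 addr0 => ->.
    by rewrite expr1n mul1r expr0n eqn0Ngt k0 mul0r addr0.
  apply: ltr_wpDl; first by rewrite mulr_ge0 ?exprn_ge0 // ltW.
  by rewrite mulr_gt0 // exprn_gt0 // lt_neqAle eq_sym t00.
pose b := row_mx z0 0 : 'rV[R]_(m + n).
have toB x : P x -> connected_component P x b.
  move=> Px; have : 0 < u (lsubmx x) \/ 0 < v (rsubmx x).
    have [|ux] := ltP 0 (u (lsubmx x)); [by left|right].
    by apply: lt_le_trans Px _; rewrite gerDr.
  rewrite -(hsubmxK x) in Px * => -[ux|vx].
    rewrite !row_mxKl in ux *; apply: connected_component_trans (toL _ _ ux Px) _.
    apply: connected_component_trans (axes _ w0 ux vw0) _.
    exact/connected_component_sym/axes.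
  rewrite !row_mxKr in vx *; apply: connected_component_trans (toR _ _ vx Px) _.
  exact/connected_component_sym/axes.
rewrite (_ : P = connected_component P b); first exact: component_connected.
apply/seteqP; split; last exact: connected_component_sub.
by move=> x /toB /connected_component_sym.
Qed.

(** On a connected set avoiding the zeros of f the sign of f is constant, by
    the intermediate value theorem; so the two sign regions, being connected,
    are full components. *)
Lemma components_sign (R : realType) (T : topologicalType) (f : T -> R) :
  continuous f ->
  connected [set x | 0 < f x] -> connected [set x | f x < 0] ->
  (exists x, 0 < f x) -> (exists x, f x < 0) ->
  (connected_components (~` [set x | f x = 0]) #= `I_2)%card.
Proof.
move=> f_cont; set A := ~` _; set P := [set x | 0 < _]; set N := [set x | _ < 0].
move=> P_conn N_conn [x0 Px0] [y0 Ny0].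
have sign_const x y : connected_component A x y -> (0 < f x) = (0 < f y).
  move=> [B [Bx BA B_conn] By].
  have /connected_intervalP fB : connected (f @` B).
    apply: connected_continuous_connected => //.
    exact: continuous_subspaceT.
  have nz z : B z -> f z <> 0 by move=> /BA.
  have key a b : B a -> B b -> 0 < f a -> 0 < f b.
    move=> Ba Bb fa; rewrite ltNge; apply/negP => fb.
    have [z Bz fz] : (f @` B) 0.
      by apply: (fB (f b) (f a)); [exists b|exists a|rewrite fb ltW].
    exact: (nz z).
  by apply/idP/idP; apply: key.
have AP : P `<=` A by move=> x; rewrite /P /A /= => + f0; rewrite f0 ltxx.
have AN : N `<=` A by move=> x; rewrite /N /A /= => + f0; rewrite f0 ltxx.
have cP x : P x -> connected_component A x = P.
  move=> Px; apply/seteqP; split; last exact: connected_component_max.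
  by move=> y /sign_const; rewrite Px /P /= => <-.
have cN x : N x -> connected_component A x = N.
  move=> Nx; apply/seteqP; split; last exact: connected_component_max.
  move=> y xy; have /connected_component_sub := xy; move/sign_const: xy.
  rewrite ltNge ltW //= /A /N /= => /esym /negbT; rewrite -leNgt le_eqVlt.
  by move=> /predU1P[-> []|].
have PN : P <> N.
  move=> /seteqP[/(_ x0 Px0)] /=; rewrite /N /= => /lt_trans/(_ Px0).
  by rewrite ltxx.
have -> : connected_components A = [set P; N].
  apply/seteqP; split => [_ [x Ax <-]|_ [->|->]] /=.
  - have [fx|fx|fx] := ltgtP (f x) 0; [right; exact: cN|left; exact: cP|].
    by case: Ax.
  - by exists x0; [exact: AP|exact: cP].
  - by exists y0; [exact: AN|exact: cN].
apply/eq_cardSP; exists P; first by left.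
rewrite (_ : _ `\` _ = [set N]) ?card_set1 //.
apply/seteqP; split => [_ [[->|->]] //=|_ ->]; split; first by right.
by move=> /esym.
Qed.

(** * Two copies of a planar harmonic polynomial *)

(** A point of the 4-space is read as a pair of planar points, the form in
    which [connected_positive_sum] applies. *)
Lemma meval_two_copies_row (R : comNzRingType) (a b : R) (q : mpoly 2 R)
    (x : 'rV[R]_(2 + 2)) :
  meval (x ord0) (two_copies a b q) =
  a * meval (lsubmx x ord0) q + b * meval (rsubmx x ord0) q.
Proof.
rewrite /two_copies mevalD !mevalZ !comp_mpoly_meval.
congr (_ * _ + _ * _); apply: meval_eq => i;
  by rewrite !tnth_map tnth_ord_tuple mevalXU mxE.
Qed.

Lemma two_copies_positive_connected (R : realType) (k : nat) (q : mpoly 2 R)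
    (a b : R) :
  (0 < k)%N -> homogeneous_harmonic k q -> a != 0 -> b != 0 ->
  connected [set x : 'rV[R]_4 | 0 < meval (x ord0) (two_copies a b q)] /\
  exists x : 'rV[R]_4, 0 < meval (x ord0) (two_copies a b q).
Proof.
move=> k0 hq a0 b0; have homq : q \is ishomog1 k mdeg by case: hq.
have qZ c t (z : 'rV[R]_2) :
    c * meval ((t *: z) ord0) q = t ^+ k * (c * meval (z ord0) q).
  rewrite mulrCA -(meval_dhomogZ _ _ homq); congr (_ * _).
  by apply: meval_eq => i; rewrite mxE.
have [z az] := harmonic_pos k0 hq a0.
have [w bw] := harmonic_pos k0 hq b0.
split; last first.
  exists (row_mx z w : 'rV[R]_(2 + 2)); rewrite meval_two_copies_row.
  by rewrite row_mxKl row_mxKr addr_gt0.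
rewrite (_ : [set _ | _] = [set x : 'rV[R]_(2 + 2) |
    0 < a * meval (lsubmx x ord0) q + b * meval (rsubmx x ord0) q]).
  by apply: (@connected_positive_sum R 2 2 k
    (fun z => a * meval (z ord0) q) (fun z => b * meval (z ord0) q)) => //;
    [exists z|exists w].
by apply/funext => x; rewrite /= -meval_two_copies_row.
Qed.

Lemma two_copies_harmonic (R : realType) (k : nat) (q : mpoly 2 R) (a b : R) :
  (0 < k)%N -> homogeneous_harmonic k q -> a != 0 -> b != 0 ->
  homogeneous_harmonic k (two_copies a b q).
Proof.
move=> k0 hq a0 b0; have [_ homq lapq] := hq; split.
- have [_ [x]] := two_copies_positive_connected k0 hq a0 b0.
  by apply: contraTneq => ->; rewrite meval0 ltxx.
- by apply: rpredD; apply: rpredZ; apply: dhomog_rename.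
- rewrite laplacianD !laplacianZ.
  rewrite !laplacian_rename ?lapq;
    [|exact: (@rshift_inj 2 2)|exact: (@lshift_inj 2 2)].
  by rewrite !comp_mpoly0 !scaler0 addr0.
Qed.

Theorem lemma1p7 (R : realType) (k : nat) (hk : (2 <= k)%N) (q : mpoly 2 R)
    (hq : homogeneous_harmonic k q) (a b : R) (ha : a != 0) (hb : b != 0) :
  homogeneous_harmonic k (two_copies a b q) /\
  (connected_components (~` zero_set (two_copies a b q)) #= `I_2)%card.
Proof.
have k0 : (0 < k)%N := ltnW hk.
split; first exact: two_copies_harmonic.
have [Pc Pn] := two_copies_positive_connected k0 hq ha hb.
have := @two_copies_positive_connected R k q (- a) (- b) k0 hq.
rewrite !oppr_eq0 => /(_ ha hb).
have pN (x : 'rV[R]_4) : (0 < meval (x ord0) (two_copies (- a) (- b) q)) =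
    (meval (x ord0) (two_copies a b q) < 0).
  by rewrite !meval_two_copies_row !mulNr -opprD oppr_gt0.
under eq_set do rewrite pN.
move=> [Nc [x]]; rewrite pN => fx.
apply: components_sign => //; last by exists x.
exact: continuous_meval.
Qed.
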